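(* Let $G$ be a finite group, let $H$ be an abelian subgroup of $G$, and let $R=\mathbb{C}[x_g ; g\in G]$. Then for every $h\in H$ there exists a homogeneous polynomial $a_h\in R$ with $\deg a_h=[G:H]$ such that $$\Theta(G)=\prod_{\chi\in\widehat{H}}\ \sum_{h\in H}\chi(h)\,a_h .$$ Moreover, if $H$ is normal in $G$ and $h,h'\in H$ are conjugate in $G$, then $a_h=a_{h'}$.
   Context: $R=\mathbb{C}[x_g ; g\in G]$ is the polynomial ring over $\mathbb{C}$ in independent commuting variables $x_g$ indexed by the elements $g$ of $G$. The group determinant of $G$ is $\Theta(G)=\det\left(x_{gh^{-1}}\right)_{g,h\in G}\in R$, the determinant of a $|G|\times|G|$ matrix. $\widehat{H}$ is a complete set of inequivalent irreducible representations of $H$ over $\mathbb{C}$; since $H$ is abelian these are the group homomorphisms $H\to\mathbb{C}^{\times}$. $[G:H]$ is the index of $H$ in $G$. *)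

(* Defs.v *)
From HB Require Import structures.
From mathcomp Require Import all_boot all_order all_fingroup all_algebra cyclic.
From mathcomp Require Import boolp classical_sets cardinality fsbigop reals.
From mathcomp Require Import complex mpoly.
Set Implicit Arguments.
Unset Strict Implicit.
Unset Printing Implicit Defensive.
Import GRing.Theory.
Local Open Scope ring_scope.

(* The field of complex numbers is R[i], for an arbitrary R : realType.       *)

(* The polynomial ring in the variables x_g, for g : gT, is {mpoly R[i][#|gT|]}*)
(* where x_g is the variable numbered by the rank of g in enum gT.            *)
Definition gvar (R : realType) (gT : finGroupType) (g : gT) : {mpoly R[i][#|gT|]} :=
  'X_(enum_rank g).

Definition group_det (R : realType) (gT : finGroupType) : {mpoly R[i][#|gT|]} :=
  \det (\matrix_(i < #|gT|, j < #|gT|)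
          gvar R (enum_val i * (enum_val j)^-1)%g).

(* The homomorphisms from hT to the multiplicative group of R[i]; when hT is  *)
(* abelian they are the irreducible representations of hT over R[i], up to    *)
(* equivalence.                                                               *)
Definition dual_group (R : realType) (hT : finGroupType)
    : set {ffun hT -> R[i]} :=
  [set chi : {ffun hT -> R[i]} | (forall x : hT, chi x != 0) /\
    (forall x y : hT, chi (x * y)%g = chi x * chi y)]%classic.

Arguments dual_group R hT : clear implicits.

(* A \big operator over a classical set takes its default value when the      *)
(* support is infinite; this lemma excludes that case for products over       *)
(* dual_group.                                                                *)
Lemma finite_dual_group (R : realType) (hT : finGroupType) :
  finite_set (dual_group R hT).
Proof.
have [s sE] := closed_field_poly_normal ('X^#|hT| - 1 : {poly R[i]}).
have rootE (x : R[i]) : x ^+ #|hT| = 1 -> x \in s.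
  move=> x1; have : root ('X^#|hT| - 1) x.
    by rewrite /root !hornerE x1 subrr.
  rewrite sE rootZ ?root_prod_XsubC //.
  by rewrite lead_coef_eq0 monic_neq0 // monicXnsubC // (cardD1 1%g).
pose f (u : {ffun hT -> seq_sub s}) : {ffun hT -> R[i]} :=
  [ffun x => ssval (u x)].
apply: (@sub_finite_set _ _ (f @` [set: {ffun hT -> seq_sub s}])%classic).
  move=> chi [chi0 chiM].
  have chi1 : chi 1%g = 1.
    by apply: (mulfI (chi0 1%g)); rewrite -chiM mulg1 mulr1.
  have chiX x n : chi (x ^+ n)%g = chi x ^+ n.
    by elim: n => [|n IH]; rewrite ?expg0 ?expr0 // expgS chiM IH exprS.
  have chis x : chi x \in s.
    by apply: rootE; rewrite -chiX -cardsT expg_cardG ?finset.in_setT.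
  exists [ffun x => SeqSub (chis x)] => //.
  by apply/ffunP => x; rewrite !ffunE.
by apply: finite_image; exact: finite_finset.
Qed.

(* Main.v *)
(* Fix a transversal t_1, ..., t_m of the left cosets of H. The block (i, j)  *)
(* of the group matrix, (x_{t_i h h'^-1 t_j^-1})_{h, h'}, is circulant on the *)
(* abelian group H, so all the blocks are diagonalised simultaneously by the  *)
(* characters of H. Hence the group determinant is the product over chi of    *)
(* det (sum_z chi(z) x_{t_i z t_j^-1})_{i, j}, and expanding this m x m       *)
(* determinant along both the permutation and the z's, collecting the terms   *)
(* whose z's multiply to h, gives the a_h.                                    *)
Require Import Defs.
From HB Require Import structures.
From mathcomp Require Import all_boot all_order all_fingroup all_algebra.
From mathcomp Require Import boolp classical_sets cardinality fsbigop reals.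
From mathcomp Require Import complex mpoly.
From mathcomp Require Import cyclic separable cyclotomic.
Import GRing.Theory.
Local Open Scope ring_scope.

Set Implicit Arguments.
Unset Strict Implicit.
Unset Printing Implicit Defensive.

(** Index [G] by pairs (h, i) standing for t_i h. The characters of [H], found as common
    eigenvectors of the translations, form a basis of the functions on [H] ([character_basis]), so a
    scalar change of basis turns the group matrix into one block [twisted_mx chi] per character
    ([fdet_group_mx]). By [det_twisted_mx], each block has determinant sum_h chi(h) a_h, where a_h =
    [det_coef h] does not depend on chi. All monomials of a_h have degree m = [G:H], and
    [det_coef_neq0] makes this its exact degree. If [H] is normal and c is conjugation by g on [H],
    the blocks of chi and of chi o c have the same determinant ([det_twisted_mx_conj]); Fourier
    inversion over [H] then gives a_(c h) = a_h ([det_coef_conj]). *)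

(** * Determinants of matrices indexed by finite types *)

(** Two numberings differ by one permutation, applied to both rows and columns, so its sign cancels.
    The sizes [m] and [n] are kept apart because they may be equal without being convertible. *)
Lemma det_reindex (R : comNzRingType) (T : finType) (F : T -> T -> R) m n
    (f : 'I_m -> T) (g : 'I_n -> T) :
  bijective f -> bijective g ->
  \det (\matrix_(i, j) F (f i) (f j)) = \det (\matrix_(i, j) F (g i) (g j)).
Proof.
move=> bf bg; have emn : m = n.
  by rewrite -(card_ord m) -(card_ord n) (bij_eq_card bf) (bij_eq_card bg).
case: _ / emn g bg => g [g' gK g'K].
have inj_s : injective (g' \o f).
  by apply: inj_comp; [exact: can_inj g'K | exact: bij_inj].
have -> : \matrix_(i, j) F (f i) (f j) =
    row_perm (perm inj_s)
      (col_perm (perm inj_s) (\matrix_(i, j) F (g i) (g j))).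
  by apply/matrixP => i j; rewrite !mxE !permE /= !g'K.
rewrite row_permE col_permE !det_mulmx !det_perm perm.odd_permV.
by rewrite mulrCA -signr_addb addbb mulr1.
Qed.

Definition fdet (R : comNzRingType) (T : finType) (F : T -> T -> R) : R :=
  \det (\matrix_(i < #|T|, j < #|T|) F (enum_val i) (enum_val j)).

Lemma fdetE (R : comNzRingType) (T : finType) (F : T -> T -> R) n
    (f : 'I_n -> T) :
  bijective f -> fdet F = \det (\matrix_(i, j) F (f i) (f j)).
Proof. by apply: det_reindex; exact: enum_val_bij. Qed.

Lemma eq_fdet (R : comNzRingType) (T : finType) (F G : T -> T -> R) :
  (forall x y, F x y = G x y) -> fdet F = fdet G.
Proof. by move=> FG; congr (\det _); apply/matrixP => i j; rewrite !mxE. Qed.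

Lemma fdet_reindex (R : comNzRingType) (S T : finType) (F : T -> T -> R)
    (f : S -> T) :
  bijective f -> fdet F = fdet (fun x y => F (f x) (f y)).
Proof. by move=> bf; apply/fdetE/bij_comp => //; exact: enum_val_bij. Qed.

Lemma fdetM (R : comNzRingType) (T : finType) (F G : T -> T -> R) :
  fdet (fun x z => \sum_y F x y * G y z) = fdet F * fdet G.
Proof.
rewrite -det_mulmx; congr (\det _); apply/matrixP => i k; rewrite !mxE.
rewrite (reindex (enum_val : 'I_#|T| -> T)) /=; last exact/onW_bij/enum_val_bij.
by apply: eq_bigr => j _; rewrite !mxE.
Qed.

Lemma fdet1 (R : comNzRingType) (T : finType) :
  fdet (fun x y : T => (x == y)%:R) = 1 :> R.
Proof.
rewrite -[RHS](det1 _ #|T|); congr (\det _); apply/matrixP => i j.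
by rewrite !mxE (inj_eq enum_val_inj).
Qed.

(** Induction on the number of blocks: [g] lists the pairs with first component [ord0] before the
    others, which exhibits a block triangular matrix. *)
Lemma fdet_block_ord (R : comNzRingType) n (T : finType)
    (F : 'I_n -> T -> T -> R) :
  fdet (fun p q : 'I_n * T => if p.1 == q.1 then F p.1 p.2 q.2 else 0) =
  \prod_i fdet (F i).
Proof.
elim: n F => [|n IHn] F.
  have e0 : #|{: 'I_0 * T}| = 0%N by rewrite card_prod card_ord.
  rewrite big_ord0 /fdet; move: (@enum_val _ _); rewrite e0 => ev.
  exact: det_mx00.
pose g (k : 'I_(#|T| + #|{: 'I_n * T}|)) : 'I_n.+1 * T :=
  match split k with
  | inl b => (ord0, enum_val b)
  | inr c => (lift ord0 (enum_val c).1, (enum_val c).2)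
  end.
have bg : bijective g.
  apply: inj_card_bij; last first.
    by rewrite !card_prod !card_ord mulSn.
  move=> k l; rewrite /g -{2}(splitK k) -{2}(splitK l).
  case: (split k) (split l) => [b|c] [b'|c'] //= [].
  - by move/enum_val_inj->.
  - move=> /addnI/val_inj e1 e2; congr (rshift _ _); apply: enum_val_inj.
    by case: (enum_val c) (enum_val c') e1 e2 => ? ? [? ?] /= -> ->.
rewrite (fdetE _ bg) big_ord_recl -IHn -(det_ublock _ 0 _).
congr (\det _); apply/matrixP => k l.
rewrite -(splitK k) -(splitK l).
case: (split k) (split l) => [b|c] [b'|c']; rewrite mxE /g !unsplitK /=.
- by rewrite block_mxEul mxE.
- by rewrite block_mxEur mxE.
- by rewrite block_mxEdl mxE.
- by rewrite block_mxEdr mxE (inj_eq lift_inj).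
Qed.

Lemma fdet_block (R : comNzRingType) (S T : finType) (F : S -> T -> T -> R) :
  fdet (fun p q : S * T => if p.1 == q.1 then F p.1 p.2 q.2 else 0) =
  \prod_s fdet (F s).
Proof.
have bf : bijective (fun p : 'I_#|S| * T => (enum_val p.1 : S, p.2)).
  exists (fun q : S * T => (enum_rank q.1, q.2)) => -[x y] /=.
    by rewrite enum_valK.
  by rewrite enum_rankK.
rewrite (fdet_reindex _ bf) /=.
under eq_fdet do rewrite (inj_eq enum_val_inj).
rewrite (fdet_block_ord (fun i => F (enum_val i))).
rewrite [RHS](reindex (enum_val : 'I_#|S| -> S)) //.
exact/onW_bij/enum_val_bij.
Qed.

Lemma fdet_ord (R : comNzRingType) n (A : 'M[R]_n) : fdet A = \det A.
Proof.
rewrite (fdetE A (f := id)); last by exists id.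
by congr (\det _); apply/matrixP => i j; rewrite mxE.
Qed.

(** * Characters of a finite abelian group *)

(** The minimal polynomial divides X^k - 1, which is separable since k is nonzero in [F]. *)
Lemma diagonalizable_expr1 (F : closedFieldType) n (A : 'M[F]_n.+1) k :
  k%:R != 0 :> F -> A ^+ k = 1 -> diagonalizable A.
Proof.
move=> k0 Ak1; have k_gt0 : (0 < k)%N by case: k k0 {Ak1} => //; rewrite eqxx.
have [s] := closed_field_poly_normal ('X^k - 1 : {poly F}).
rewrite (monicP _) ?monicXnsubC // scale1r => sE.
apply/diagonalizableP; exists s.
  by rewrite -separable_prod_XsubC -sE separable_Xn_sub_1.
rewrite -sE; apply: mxminpoly_min.
by rewrite rmorphB rmorphXn /= horner_mx_X rmorph1 Ak1 subrr.
Qed.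

Section DualGroup.
Variables (F : closedFieldType) (hT : finGroupType).
Hypothesis abT : abelian [set: hT].
Hypothesis card_neq0 : #|hT|%:R != 0 :> F.

Lemma mulT_comm (x y : hT) : (x * y = y * x)%g.
Proof. by apply: (centsP abT); rewrite finset.in_setT. Qed.

(* Simultaneously diagonalising the regular representation yields a basis of  *)
(* characters: an eigenvector, seen as a function on hT, is a multiple of the *)
(* character of its eigenvalues.                                              *)
Lemma character_basis :
  exists e : hT -> {ffun hT -> F}, exists e' : hT -> hT -> F,
  [/\ forall k x, e k x != 0,
      forall k x y, e k (x * y)%g = e k x * e k y,
      forall x y, \sum_k e k x * e' k y = (x == y)%:R
    & forall k l, \sum_x e' k x * e l x = (k == l)%:R].
Proof.
have [n nE] : exists n, #|hT| = n.+1 by rewrite (cardD1 1%g); eexists.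
have [f [f' fK f'K]] : exists f : 'I_n.+1 -> hT, bijective f.
  by rewrite -nE; exists enum_val; exact: enum_val_bij.
pose reg x : 'M[F]_n.+1 := \matrix_(i, j) (f i == f j * x)%g%:R.
have mul_reg m (A : 'M_(m, n.+1)) x i j :
    (A *m reg x) i j = A i (f' (f j * x)%g).
  rewrite mxE (bigD1 (f' (f j * x)%g)) //= mxE f'K eqxx mulr1.
  rewrite big1 ?addr0 // => l ln.
  by rewrite mxE -(can_eq fK) f'K in ln *; rewrite (negPf ln) mulr0.
have regM x y : reg (x * y)%g = reg x *m reg y.
  by apply/matrixP => i j; rewrite mul_reg !mxE f'K -mulgA (mulT_comm y).
have reg1 : reg 1%g = 1.
  by apply/matrixP => i j; rewrite !mxE mulg1 (can_eq fK).
have regX x m : reg (x ^+ m)%g = reg x ^+ m.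
  by elim: m => [|m IH]; rewrite ?expg0 ?expr0 // expgS exprS regM IH.
have /codiagonalizableP[P Pu /allP Pdiag] :
    {in [seq reg x | x <- enum hT] &, forall A B, comm_mx A B} /\
    {in [seq reg x | x <- enum hT], forall A, diagonalizable A}.
  split=> [_ _ /mapP[x _ ->] /mapP[y _ ->]|_ /mapP[x _ ->]].
    by rewrite /comm_mx -!regM mulT_comm.
  apply: (@diagonalizable_expr1 _ _ _ #|hT|) => //.
  by rewrite -regX -reg1 -cardsT expg_cardG ?finset.in_setT.
(* Row [i] of [P], read as a function on [hT], is scaled by every translation. *)
have eigen i x : exists c, forall y, P i (f' (y * x)%g) = c * P i (f' y).
  have /Pdiag/diagonalizable_forPex[d /(simmxP Pu) Pd] :
      reg x \in [seq reg x | x <- enum hT].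
    by apply: map_f; rewrite mem_enum.
  exists (d 0 i) => y.
  by move/matrixP/(_ i (f' y)): Pd; rewrite mul_reg f'K mul_diag_mx !mxE.
have P1_neq0 i : P i (f' 1%g) != 0.
  apply: contraTneq Pu => P1_0; apply: contraL (oner_neq0 F) => Pu.
  have rowP0 : row i P = 0.
    apply/rowP => j; rewrite !mxE -(fK j) -[f j]mul1g.
    by have [c ->] := eigen i (f j); rewrite P1_0 mulr0.
  have := mulmxV Pu => /(congr1 (row i)); rewrite row_mul rowP0 mul0mx.
  by move/matrixP/(_ 0 i); rewrite !mxE eqxx negbK => /esym/eqP.
(* Normalised to take the value 1 at the identity, an eigenvector coincides with its eigenvalues and
   so is multiplicative. Here [k] is a mere label: [hT] serves as an index set of the right size. *)
pose e (k : hT) : {ffun hT -> F} :=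
  [ffun x => P (f' k) (f' x) / P (f' k) (f' 1%g)].
have eM k x y : e k (x * y)%g = e k x * e k y.
  have [c ec] := eigen (f' k) y; rewrite !ffunE ec -[y in RHS]mul1g ec.
  by rewrite mulfK // [RHS]mulrC mulrA.
have e1 k : e k 1%g = 1 by rewrite ffunE divff.
pose E := \matrix_(i, j) e (f i) (f j).
have Eu : E \in unitmx.
  have -> : E = diag_mx (\row_i (P i (f' 1%g))^-1) *m P.
    by apply/matrixP => i j; rewrite mul_diag_mx !mxE ffunE !fK mulrC.
  rewrite unitmx_mul Pu andbT unitmxE det_diag unitfE.
  by apply/prodf_neq0 => i _; rewrite mxE invr_eq0.
have sumE (G : 'I_n.+1 -> F) : \sum_x G (f' x) = \sum_i G i.
  rewrite (reindex f) /=; last by exists f' => ? _.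
  by apply: eq_bigr => i _; rewrite fK.
(* [e'] is the inverse of the character table [E]; the two sums are its left and right inverse
   identities. *)
exists e, (fun k x => invmx E (f' x) (f' k)); split=> // [k x|x y|k l].
- apply: contraTneq (oner_neq0 F) => e0.
  by rewrite -(e1 k) -(mulgV x) eM e0 mul0r eqxx.
- move/matrixP/(_ (f' y) (f' x)): (mulVmx Eu).
  rewrite !mxE eq_sym (can_eq f'K) => <-.
  rewrite -sumE; apply: eq_bigr => k _.
  by rewrite mulrC !mxE !f'K.
- move/matrixP/(_ (f' l) (f' k)): (mulmxV Eu).
  rewrite !mxE eq_sym (can_eq f'K) => <-.
  rewrite -sumE; apply: eq_bigr => x _.
  by rewrite mulrC !mxE !f'K.
Qed.

Section CharacterBasis.
Variables (e : hT -> {ffun hT -> F}) (e' : hT -> hT -> F).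
Hypothesis eM : forall k x y, e k (x * y)%g = e k x * e k y.
Hypothesis sum_ee' : forall x y, \sum_k e k x * e' k y = (x == y)%:R.
Hypothesis sum_e'e : forall k l, \sum_x e' k x * e l x = (k == l)%:R.

Lemma character_basis_inj : injective e.
Proof.
move=> k l ekl; apply/eqP; have := sum_e'e k l; rewrite -ekl sum_e'e eqxx.
by case: eqP => // _ /eqP; rewrite oner_eq0.
Qed.

(** Expand chi = sum_k c_k e_k. Translating by z and comparing coefficients gives c_k chi(z) = c_k
    e_k(z), so chi = e_k for any k with c_k nonzero. *)
Lemma character_basis_surj (chi : {ffun hT -> F}) :
  (forall x, chi x != 0) -> (forall x y, chi (x * y)%g = chi x * chi y) ->
  exists k, chi = e k.
Proof.
move=> chi0 chiM; pose c k := \sum_y e' k y * chi y.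
have chiE x : chi x = \sum_k c k * e k x.
  under eq_bigr do rewrite mulr_suml; rewrite exchange_big /=.
  rewrite (bigD1 x) //= [X in _ + X]big1 => [|y yx]; rewrite ?addr0.
    under eq_bigr do rewrite mulrAC mulrC [e' _ _ * _]mulrC.
    by rewrite -mulr_sumr sum_ee' eqxx mulr1.
  under eq_bigr do rewrite mulrAC mulrC [e' _ _ * _]mulrC.
  by rewrite -mulr_sumr sum_ee' eq_sym (negPf yx) mulr0.
have c_eigen k z : c k * chi z = c k * e k z.
  have cE (d : hT -> F) : \sum_y e' k y * (\sum_l d l * e l y) = d k.
    under eq_bigr do rewrite mulr_sumr; rewrite exchange_big /=.
    under eq_bigr => l _ do under eq_bigr do rewrite mulrCA.
    under eq_bigr => l _ do rewrite -mulr_sumr sum_e'e.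
    rewrite (bigD1 k) //= eqxx mulr1 big1 ?addr0 // => l lk.
    by rewrite eq_sym (negPf lk) mulr0.
  rewrite -(cE (fun l => c l * e l z)) /c mulr_suml; apply: eq_bigr => y _.
  rewrite -mulrA -chiM chiE; congr (_ * _); apply: eq_bigr => l _.
  by rewrite mulT_comm eM mulrA.
have [k ck0] : exists k, c k != 0.
  apply/existsP; apply: contraNT (chi0 1%g); rewrite negb_exists => /forallP c0.
  rewrite chiE big1 // => k _; move: (c0 k).
  by rewrite negbK => /eqP->; rewrite mul0r.
by exists k; apply/ffunP => z; apply: (mulfI ck0).
Qed.

End CharacterBasis.
End DualGroup.

(** * Factorisation of the group determinant and properties of the coefficients *)

Section GroupDeterminant.
Variables (F : closedFieldType) (gT hT : finGroupType).
Variables (iota : hT -> gT) (m : nat) (t : 'I_m -> gT).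
Hypothesis iotaM : {morph iota : x y / (x * y)%g}.
Hypothesis t_bij : bijective (fun p : hT * 'I_m => t p.2 * iota p.1)%g.

Local Notation x g := ('X_(enum_rank g) : {mpoly F[#|gT|]}).

Lemma iota1 : iota 1%g = 1%g.
Proof. by apply: (mulgI (iota 1%g)); rewrite -iotaM !mulg1. Qed.

Lemma iotaV y : iota y^-1%g = (iota y)^-1%g.
Proof. by apply: (mulgI (iota y)); rewrite -iotaM !mulgV iota1. Qed.

(** Entry (i, j) is the eigenvalue at [chi] of block (i, j) of the group matrix. [chi] is a bare
    function, so that [chi \o c] can be substituted. *)
Definition twisted_mx (chi : hT -> F) : 'M[{mpoly F[#|gT|]}]_m :=
  \matrix_(i, j) \sum_z chi z *: x (t i * iota z * (t j)^-1)%g.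

Definition det_coef (h : hT) : {mpoly F[#|gT|]} :=
  \sum_(s : 'S_m) \sum_(k : {ffun 'I_m -> hT} | (\prod_i k i)%g == h)
    (-1) ^+ s *: 'X_[\sum_i U_(enum_rank (t i * iota (k i) * (t (s i))^-1)%g)].

(** In the Leibniz expansion each term picks an element k_i in row i; multiplicativity merges the
    scalars chi(k_i) into chi of their product, by which the terms are sorted. *)
Lemma det_twisted_mx (chi : hT -> F) :
  (forall y, chi y != 0) -> (forall y z, chi (y * z)%g = chi y * chi z) ->
  \det (twisted_mx chi) = \sum_h chi h *: det_coef h.
Proof.
move=> chi0 chiM; have chi1 : chi 1%g = 1.
  by apply: (mulfI (chi0 1%g)); rewrite -chiM mulg1 mulr1.
under [RHS]eq_bigr do rewrite scaler_sumr; rewrite exchange_big /=.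
apply: eq_bigr => s _.
under [RHS]eq_bigr do rewrite scaler_sumr.
under [in LHS]eq_bigr do rewrite mxE.
rewrite bigA_distr_bigA mulr_sumr.
rewrite (partition_big (fun k : {ffun 'I_m -> hT} => \prod_i k i)%g xpredT) //=.
apply: eq_bigr => h _; apply: eq_bigr => k /eqP <-.
rewrite (big_morph chi chiM chi1) scaler_prod.
rewrite (big_morph (fun u => 'X_[u] : {mpoly F[#|gT|]})
  (@mpolyXD _ _) (@mpolyX0 _ _)).
rewrite -scalerAr; congr (_ *: _).
by rewrite -signr_odd -mul_mpolyC rmorph_sign signr_odd.
Qed.

Lemma homog_det_coef h : det_coef h \is m.-homog.
Proof.
apply: rpred_sum => s _; apply: rpred_sum => k _; apply: rpredZ.
rewrite dhomogX /= mdeg_sum; apply/eqP.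
by under eq_bigr do rewrite mdeg1; rewrite sum1_card card_ord.
Qed.

Lemma transversal_coset_inj i j y z :
  (t i * iota y = t j * iota z)%g -> (y, i) = (z, j).
Proof. by move=> eq_t; apply: (bij_inj t_bij). Qed.

(* If x_1^(m-1) divides a monomial of the expansion then s fixes at least m-1 *)
(* points, hence s = 1: there is no cancellation in its coefficient.          *)
Lemma det_coef_neq0 h : [pchar F] =i pred0 -> det_coef h != 0.
Proof.
move=> /pcharf0P char0.
(* Any index would do for [i0]. With the identity permutation, [k0] yields a monomial containing x_1
   at least m-1 times. *)
have [f' _ f'K] := t_bij; pose i0 := (f' 1%g).2.
pose k0 : {ffun 'I_m -> hT} := [ffun i => if i == i0 then h else 1%g].
have k0h : (\prod_i k0 i)%g == h.
  under eq_bigr do rewrite ffunE.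
  by rewrite -big_mkcond big_pred1_eq.
pose mon (s : 'S_m) (k : {ffun 'I_m -> hT}) : 'X_{1.. #|gT|} :=
  (\sum_i U_(enum_rank (t i * iota (k i) * (t (s i))^-1)%g))%MM.
have mon1 s k : mon s k (enum_rank 1%g) =
    #|[pred i | t i * iota (k i) == t (s i)]%g|.
  rewrite mnm_sumE -[RHS]sum1_card [RHS]big_mkcond /=; apply: eq_bigr => i _.
  by rewrite mnm1E (inj_eq enum_rank_inj) -eq_mulgV1 inE; case: (_ == _).
have mon_fix s k : mon s k = mon 1%g k0 -> s = 1%g.
  move=> /(congr1 (fun u : 'X_{1.. #|gT|} => u (enum_rank 1%g))).
  rewrite !mon1 => eq_card1; apply/permP => i; rewrite perm1.
  have fixP j : (t j * iota (k j) == t (s j))%g -> s j = j.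
    by rewrite -[t (s j)]mulg1 -iota1 => /eqP/transversal_coset_inj[].
  apply/eqP; apply: contraT => si.
  (* A moved point [i] comes with a second one, [s i], leaving at most m-2 factors x_1. *)
  have ssi : s (s i) != s i by rewrite (inj_eq perm_inj).
  suff : (#|[pred i | t i * iota (k i) == t (s i)]%g| <
          #|[pred i | t i * iota (k0 i) == t ((1%g : 'S_m) i)]%g|)%N.
    by rewrite eq_card1 ltnn.
  have le_m : (#|[pred i | t i * iota (k i) == t (s i)]%g| <=
               #|[predC pred2 i (s i)]|)%N.
    apply/subset_leq_card/fintype.subsetP => j; rewrite !inE => /fixP sj.
    apply/norP.
    by split; [apply: contraNneq si | apply: contraNneq ssi] => <-; rewrite sj.
  apply: (leq_ltn_trans le_m).
  have : (#|predC1 i0| <=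
          #|[pred i | t i * iota (k0 i) == t ((1%g : 'S_m) i)]%g|)%N.
    apply/subset_leq_card/fintype.subsetP => j; rewrite !inE => /negPf j0.
    by rewrite ffunE j0 iota1 mulg1 perm1.
  apply: leq_trans.
  have := cardC1 i0; have := cardC (pred2 i (s i)).
  by rewrite card2 eq_sym si => cardE; rewrite -cardE => ->.
apply/eqP => /(congr1 (mcoeff (mon 1%g k0))); rewrite mcoeff0 => /eqP.
(* Only [s = 1], of sign +1, contributes, so the coefficient counts pairs (s, k); the count is
   positive, hence nonzero in characteristic 0. *)
suff -> : (det_coef h)@_(mon 1%g k0) =
    (\sum_(s : 'S_m) \sum_(k : {ffun 'I_m -> hT} | (\prod_i k i)%g == h)
      (mon s k == mon 1%g k0))%:R.
  by rewrite char0 (bigD1 1%g) //= (bigD1 k0) //= eqxx.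
rewrite raddf_sum natr_sum; apply: eq_bigr => s _.
rewrite raddf_sum natr_sum; apply: eq_bigr => k _.
rewrite /= mcoeffZ mcoeffX -/(mon s k).
by case: eqP => [/mon_fix->|_]; rewrite ?mulr0 // odd_perm1 mul1r.
Qed.

(* Right translation by g permutes the left cosets of iota hT, so it changes  *)
(* the twisted matrix only by a permutation of the indices and a conjugation  *)
(* by a diagonal matrix.                                                      *)
Lemma det_twisted_mx_conj (chi : hT -> F) (c : hT -> hT) (g : gT) :
    (forall y, chi y != 0) -> (forall y z, chi (y * z)%g = chi y * chi z) ->
    (forall y, iota (c y) = iota y ^ g)%g -> bijective c ->
  \det (twisted_mx (chi \o c)) = \det (twisted_mx chi).
Proof.
move=> chi0 chiM cE [c' cK c'K].
have [f' fK f'K] := t_bij.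
pose l i := (f' (t i * g)%g).1; pose pi i := (f' (t i * g)%g).2.
have tg i : (t i * g = t (pi i) * iota (l i))%g by rewrite -[LHS]f'K.
have chi1 : chi 1%g = 1.
  by apply: (mulfI (chi0 1%g)); rewrite -chiM mulg1 mulr1.
have chiV y : chi y^-1%g = (chi y)^-1.
  by apply: (mulfI (chi0 y)); rewrite -chiM mulgV chi1 divff.
have -> : twisted_mx (chi \o c) =
    diag_mx (\row_i (chi (l i))^-1%:MP)
    *m (\matrix_(i, j) twisted_mx chi (pi i) (pi j))
    *m diag_mx (\row_i (chi (l i))%:MP).
  apply/matrixP => i j; rewrite mul_mx_diag mul_diag_mx !mxE.
  rewrite mulr_sumr mulr_suml.
  (* Since t_i g = t_(pi i) l_i, this substitution gives t_(pi i) d(z) t_(pi j)^-1 = t_i z t_j^-1,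
     while the diagonal factors absorb chi(l_i) and chi(l_j)^-1. *)
  pose d z := (l i * c z * (l j)^-1)%g.
  rewrite [RHS](reindex d) /=; last first.
    exists (fun z => c' ((l i)^-1 * z * l j)%g) => z _; rewrite /d.
      by rewrite !mulgA mulVg mul1g mulgKV cK.
    by rewrite c'K !mulgA mulgV mul1g mulgK.
  apply: eq_bigr => z _.
  rewrite mul_mpolyC scalerA mulrC mul_mpolyC scalerA /d !chiM chiV.
  rewrite !mulrA -[_ * chi (c z)]mulrA; congr (_ *: 'X_(enum_rank _)).
    by rewrite mulrC !mulrA mulfVK ?mulVf ?mul1r // mulrAC mulVf ?mul1r.
  rewrite !iotaM iotaV cE conjgE.
  have -> : t (pi i) = (t i * g * (iota (l i))^-1)%g by rewrite tg mulgK.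
  have -> : t (pi j) = (t j * g * (iota (l j))^-1)%g by rewrite tg mulgK.
  by rewrite !invMg !invgK !mulgA !(mulgKV, mulgK).
rewrite !det_mulmx !det_diag mulrAC -big_split /= big1 ?mul1r => [|i _].
  (* As [c] is onto, conjugation by g^-1 also preserves the image of [iota]: t_i and t_j lie in one
     left coset as soon as t_i g and t_j g do. *)
  have pi_inj : injective pi.
    move=> i j pij; have := tg i; rewrite pij => tgi.
    have ti : t i = (t j * iota (c' ((l j)^-1 * l i)))%g.
      have := cE (c' ((l j)^-1 * l i))%g; rewrite c'K iotaM iotaV.
      move=> /(congr1 (conjg^~ g^-1))%g.
      rewrite -conjgM mulgV conjg1 => <-; rewrite conjgE invgK !mulgA tg mulgK.
      by rewrite -tgi mulgK.
    have ti1 : t i = (t i * iota 1)%g by rewrite iota1 mulg1.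
    by rewrite ti1 in ti; have [] := transversal_coset_inj ti.
  rewrite (det_reindex _ (injF_bij pi_inj) (g := id)); last by exists id.
  by congr (\det _); apply/matrixP => i j; rewrite mxE.
by rewrite !mxE -mpolyCM mulVf.
Qed.

Section Factorization.
Variables (e : hT -> {ffun hT -> F}) (e' : hT -> hT -> F).
Hypothesis e_neq0 : forall k x, e k x != 0.
Hypothesis eM : forall k x y, e k (x * y)%g = e k x * e k y.
Hypothesis sum_ee' : forall x y, \sum_k e k x * e' k y = (x == y)%:R.

(* The matrix P whose columns are the functions t_i h |-> chi(h^-1) block-    *)
(* diagonalises the group matrix.                                             *)
Lemma fdet_group_mx :
  fdet (fun g g' : gT => x (g * g'^-1)%g) = \prod_k \det (twisted_mx (e k)).
Proof.
rewrite (fdet_reindex _ t_bij) /=.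
pose M (p q : hT * 'I_m) := x (t p.2 * iota p.1 * (t q.2 * iota q.1)^-1)%g.
pose D (p q : hT * 'I_m) :=
  if p.1 == q.1 then twisted_mx (e p.1) p.2 q.2 else 0.
pose P (p q : hT * 'I_m) : {mpoly F[#|gT|]} :=
  (e q.1 p.1^-1%g *+ (p.2 == q.2))%:MP.
pose Q (p q : hT * 'I_m) : {mpoly F[#|gT|]} :=
  (e' p.1 q.1^-1%g *+ (p.2 == q.2))%:MP.
(* [Q] is inverse to [P] by the duality of [e] and [e'], so [fdet P] can be cancelled from M P = P
   D. *)
have PQ : fdet P * fdet Q = 1.
  rewrite -fdetM -(fdet1 _ (hT * 'I_m)%type); apply: eq_fdet => -[y i] [z j].
  rewrite -(pair_bigA _ (fun k l => P (y, i) (k, l) * Q (k, l) (z, j))) /=.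
  transitivity ((\sum_k e k y^-1%g * e' k z^-1%g) *+ (i == j))%:MP_[#|gT|].
    rewrite -sumrMnl raddf_sum; apply: eq_bigr => k _ /=.
    rewrite (bigD1 i) //= [X in _ + X]big1 => [|l li]; rewrite ?addr0.
      by rewrite -mpolyCM eqxx mulr1n mulrnAr.
    by rewrite -mpolyCM eq_sym (negPf li) mulr0n mul0r.
  by rewrite sum_ee' (inj_eq invg_inj) -mulrnA mulnb mpolyC_nat xpair_eqE.
have MP : fdet M * fdet P = fdet P * fdet D.
  rewrite -(fdetM M P) -(fdetM P D); apply: eq_fdet => -[y i] [k j].
  transitivity (e k y^-1%g *: twisted_mx (e k) i j).
    rewrite -(pair_bigA _ (fun z l => M (y, i) (z, l) * P (z, l) (k, j))) /=.
    rewrite mxE scaler_sumr.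
    rewrite [RHS](reindex_inj (inj_comp (mulgI y) invg_inj)) /=.
    apply: eq_bigr => z _.
    rewrite (bigD1 j) //= [X in _ + X]big1 => [|l lj]; rewrite ?addr0;
      last first.
      by rewrite /P /= (negPf lj) mulr0n mulr0.
    rewrite /M /P /= eqxx mulr1n mulrC mul_mpolyC scalerA -eM mulKg.
    congr (_ *: 'X_(enum_rank _)).
    by rewrite iotaM iotaV invMg !mulgA.
  rewrite -(pair_bigA _ (fun z l => P (y, i) (z, l) * D (z, l) (k, j))) /=.
  rewrite (bigD1 k) //= [X in _ + X]big1 => [|l lk]; rewrite ?addr0; last first.
    by rewrite big1 // => l' _; rewrite /D /= (negPf lk) mulr0.
  rewrite (bigD1 i) //= [X in _ + X]big1 => [|l li]; rewrite ?addr0; last first.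
    by rewrite /P /= eq_sym (negPf li) mulr0n mul0r.
  by rewrite /P /D /= !eqxx mulr1n mul_mpolyC.
have cancelP (a b c d : {mpoly F[#|gT|]}) : b * d = 1 -> a * b = b * c -> a = c.
  by move=> bd ab; rewrite -[a]mulr1 -bd mulrA ab mulrAC bd mul1r.
rewrite (cancelP _ _ _ _ PQ MP) (fdet_block (fun k => twisted_mx (e k))).
by apply: eq_bigr => k _; rewrite fdet_ord.
Qed.

(** Equality of the determinants for chi and chi o c says that the function c(y) |-> a_(c y) - a_y
    pairs to zero with every character; inversion by [e'] isolates its value at [c h]. *)
Lemma det_coef_conj (c : hT -> hT) (g : gT) h :
    (forall y, iota (c y) = iota y ^ g)%g -> bijective c ->
  det_coef (c h) = det_coef h.
Proof.
move=> cE bc; have [c' cK c'K] := bc.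
have cM y z : c (y * z)%g = (c y * c z)%g.
  have iota_inj : injective iota.
    move=> u v uv; have [f' _ _] := t_bij; pose i := (f' 1%g).2.
    by have [] : (u, i) = (v, i) by apply: transversal_coset_inj; rewrite uv.
  by apply: iota_inj; rewrite cE !iotaM conjMg !cE.
have sum0 k : \sum_y e k (c y) *: (det_coef (c y) - det_coef y) = 0.
  under eq_bigr do rewrite scalerBr; rewrite sumrB.
  rewrite -(reindex c (P := xpredT) (F := fun y => e k y *: det_coef y)) /=;
    last exact: onW_bij.
  rewrite -det_twisted_mx // -(det_twisted_mx_conj _ _ cE) //.
  by rewrite det_twisted_mx ?subrr //= => y z; rewrite cM eM.
apply/eqP; rewrite -subr_eq0; apply/eqP.
transitivity (\sum_k e' k (c h) *:
                \sum_y e k (c y) *: (det_coef (c y) - det_coef y)); last first.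
  by rewrite big1 // => k _; rewrite sum0 scaler0.
under [RHS]eq_bigr do rewrite scaler_sumr; rewrite exchange_big /=.
transitivity (\sum_y (c y == c h)%:R *: (det_coef (c y) - det_coef y)).
  rewrite (bigD1 h) //= eqxx scale1r big1 ?addr0 // => y yh.
  by rewrite (can_eq cK) (negPf yh) scale0r.
apply: eq_bigr => y _; under eq_bigr do rewrite scalerA mulrC.
by rewrite -scaler_suml sum_ee'.
Qed.

End Factorization.
End GroupDeterminant.

(** * Left transversal and conclusion *)

(** The index counts right cosets, so the inverses of right coset representatives are taken. *)
Lemma lcoset_transversal (gT : finGroupType) (H : {group gT}) :
  exists t : 'I_#|[set: gT] : H|%g -> gT,
    bijective (fun p : [subg H] * 'I_#|[set: gT] : H|%g => t p.2 * sgval p.1)%g.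
Proof.
pose C (i : 'I_#|[set: gT] : H|%g) := @enum_val _ (mem (rcosets H [set: gT])) i.
have CE i : (C i = H :* repr (C i))%g.
  have /rcosetsP[u _ ->] : C i \in rcosets H [set: gT] := enum_valP i.
  by rewrite rcoset_repr.
exists (fun i => (repr (C i))^-1)%g.
apply: inj_card_bij => [[y i] [z j] /= eq_t|]; last first.
  by rewrite card_prod card_ord card_sub -cardsT -(Lagrange (finset.subsetT H)).
have eq_r : (repr (C j) = sgval z * (sgval y)^-1 * repr (C i))%g.
  have /(congr1 invg) := eq_t; rewrite !invMg !invgK -mulgA => ->.
  by rewrite mulKVg.
have zyH : (sgval z * (sgval y)^-1)%g \in H.
  by apply: groupM; rewrite ?groupV; exact: subgP.
have eij : i = j.
  apply: (@enum_val_inj _ (mem (rcosets H [set: gT]))); rewrite -/(C i) -/(C j).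
  by rewrite (CE i) (CE j) eq_r rcosetM (rcoset_id zyH).
by move: eq_t; rewrite eij => /mulgI/val_inj->.
Qed.

Theorem theorem6 (R : realType) (gT : finGroupType) (H : {group gT})
    (abH : abelian H) :
  exists a : [subg H] -> {mpoly R[i][#|gT|]},
    [/\ forall h : [subg H],
          a h \is #|[set: gT] : H|%g.-homog /\ msize (a h) = #|[set: gT] : H|%g.+1,
        group_det R gT =
          \big[*%R/1]_(chi \in dual_group R [subg H])
            (\sum_(h : [subg H]) chi h *: a h)
      & (H <| [set: gT])%g ->
        forall h h' : [subg H],
          (sgval h' \in sgval h ^: [set: gT])%g -> a h = a h'].
Proof.
have abT : abelian [set: [subg H]].
  apply/centsP => y _ z _; apply: val_inj.
  by apply: (centsP abH); exact: subgP.
have card0 : #|[subg H]|%:R != 0 :> R[i].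
  by rewrite Num.Theory.pnatr_eq0 -lt0n (cardD1 1%g).
have [e [e' [e0 eM sum_ee' sum_e'e]]] := character_basis abT card0.
have [t t_bij] := lcoset_transversal H.
have sgvalM : {morph (sgval : [subg H] -> gT) : y z / (y * z)%g} by [].
exists (det_coef R[i] (sgval : [subg H] -> gT) t); split.
- move=> h; have a_homog := homog_det_coef R[i] (sgval : [subg H] -> gT) t h.
  split=> //.
  (* [msize] is the degree plus one, but 0 for the zero polynomial; hence the need for a_h to be
     nonzero. *)
  have := det_coef_neq0 sgvalM t_bij h (Num.Theory.pchar_num R[i]).
  move=> a_neq0; rewrite -(mlead_deg a_neq0).
  by move/dhomogP: a_homog => /(_ _ (mlead_supp a_neq0)) /= ->.
- have -> : dual_group R [subg H] = [set` [seq e k | k <- enum [subg H]]]%classic.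
    apply/seteqP; split => chi /=.
      move=> [chi0 chiM].
      have [k ->] := character_basis_surj abT eM sum_ee' sum_e'e chi0 chiM.
      by apply/map_f; rewrite mem_enum.
    by move=> /mapP[k _ ->]; split; [exact: e0 | exact: eM].
  (* Distinct labels give distinct characters, so the product over the set is the product over the
     list. *)
  rewrite -fsbig_seq; last first.
    by rewrite map_inj_uniq ?enum_uniq //; exact: character_basis_inj sum_e'e.
  rewrite big_map big_enum /=.
  have -> : group_det R gT = fdet (fun g g' : gT => gvar R (g * g'^-1)%g) by [].
  rewrite (fdet_group_mx sgvalM t_bij eM sum_ee').
  by apply: eq_bigr => k _; rewrite det_twisted_mx.
- move=> nH h h' /imsetP[g _ hg].
  have cH (y : [subg H]) : (sgval y ^ g)%g \in H.
    rewrite memJ_norm ?subgP //.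
    by rewrite (fintype.subsetP (normal_norm nH)) ?finset.in_setT.
  pose c (y : [subg H]) := subg H (sgval y ^ g)%g.
  have cE y : sgval (c y) = (sgval y ^ g)%g by rewrite subgK.
  have cb : bijective c.
    by apply/injF_bij => y z /(congr1 sgval); rewrite !cE => /conjg_inj/val_inj.
  have -> : h' = c h by apply: subg_inj; rewrite cE.
  by rewrite (det_coef_conj sgvalM t_bij e0 eM sum_ee' h cE cb).
Qed.
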